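(* Let $f:P\times X\to Y$ be $K$-closed and $K$-convex. Let $g_i:P\times X\to\mathbb R$, $i=1,\dots,m+r$, be continuously differentiable convex functions, and let $C:P\rightrightarrows X$ be a convex closed set-valued map given by $$C(p)=\{x\in X\mid g_i(p,x)\le 0,\ i=1,\dots,m;\ g_i(p,x)=0,\ i=m+1,\dots,m+r\}.$$ Let $(\bar p,\bar x)\in\mathrm{gph}\,\mathcal S$ and $\bar y=f(\bar p,\bar x)$. Let $H:P\rightrightarrows P\times X$ be defined by $H(p)=\{p\}\times C(p)$. Suppose that (i) $\mathbb{R}^+(\mathrm{rge}\,H-\mathrm{dom}\,f)$ is a closed subspace of $P\times X$; (ii) $\mathbb{R}^+(P-\mathrm{dom}\,C)$ is a closed subspace of $P$; that $C$ satisfies the Abadie constraint qualification (ACQ) at $(\bar p,\bar x)$, and that $F$ is $K$-dominated by $\mathcal F$ near $\bar p$. Then, for every $y^*\in Y^*$, $$\widehat D^*(\mathcal F+K)(\bar p,\bar y)(y^* )=\bigcup_{(p^*,x^* )\in D^*(f+K)(\bar p,\bar x)(y^* )}\ \bigcup_{\lambda\in\Lambda(\bar p,\bar x,x^* )}\Big\{p^*+\sum_{i=1}^{m+r}\lambda_i\nabla_p g_i(\bar p,\bar x)\Big\},$$ where $$\Lambda(\bar p,\bar x,x^* )=\Big\{\lambda\in\mathbb R^{m+r}\ \Big|\ -x^*=\sum_{i=1}^{m+r}\lambda_i\nabla_x g_i(\bar p,\bar x),\ \lambda_i\ge 0,\ \lambda_ig_i(\bar p,\bar x)=0\ \text{for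 } i=1,\dots,m\Big\}.$$ In particular, if $f$ is continuously differentiable at $(\bar p,\bar x)$, then for every $y^*\in K^*$, $$\widehat D^*(\mathcal F+K)(\bar p,\bar y)(y^* )=\bigcup_{\lambda\in\Lambda(\bar p,\bar x,\nabla_xf(\bar p,\bar x)^*(y^* ))}\Big\{\nabla_pf(\bar p,\bar x)^*(y^* )+\sum_{i=1}^{m+r}\lambda_i\nabla_p g_i(\bar p,\bar x)\Big\}.$$
   Context: $X,Y,P$ are Banach spaces with duals $X^*,Y^*,P^*$; products carry the norm $\|(x,y)\|=\|x\|+\|y\|$. $K\subseteq Y$ is a pointed, closed, convex cone with apex at the origin, and $K^*=\{y^*\in Y^*\mid \langle y^*,k\rangle\ge 0\ \forall k\in K\}$. For a set $\Omega$, $\mathbb{R}^+(\Omega)=\mathrm{cone}\,\Omega=\{\lambda a\mid \lambda\ge 0,\ a\in\Omega\}$. For a set-valued map $G:U\rightrightarrows V$ between Banach spaces: $\mathrm{dom}\,G=\{u\mid G(u)\ne\emptyset\}$, $\mathrm{gph}\,G=\{(u,v)\mid v\in G(u)\}$, $\mathrm{rge}\,G=\bigcup_{u\in U}G(u)$. $G$ is convex (closed) if $\mathrm{gph}\,G$ is convex (closed). If $V=Y$, $\mathrm{epi}\,G=\{(u,y)\mid y\in G(u)+K\}$, $G$ is $K$-convex ($K$-closed) if $\mathrm{epi}\,G$ is convex (closed), and the profile map is $(G+K)(u)=G(u)+K$, so that $\mathrm{gph}(G+K)=\mathrm{epi}\,G$. All set-valued maps are assumed proper (nonempty domain). A single-valued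 map is regarded as the set-valued map with singleton values. For a convex set-valued map $G$ and $(\bar u,\bar v)\in\mathrm{gph}\,G$, the coderivative is $D^*G(\bar u,\bar v)(v^* )=\{u^*\in U^*\mid (u^*,-v^* )\in N((\bar u,\bar v),\mathrm{gph}\,G)\}$ for $v^*\in V^*$, where for a convex set $\Omega$ and $\bar w\in\Omega$, $N(\bar w,\Omega)=\{w^*\mid \langle w^*,w-\bar w\rangle\le 0\ \forall w\in\Omega\}$. $D^*(f+K)(\bar p,\bar x)$ denotes the coderivative of $f+K$ at the point $((\bar p,\bar x),f(\bar p,\bar x))$. For an arbitrary (possibly nonconvex) $G$ and $(\bar u,\bar v)\in\mathrm{gph}\,G$, the Fréchet coderivative is $\widehat D^*G(\bar u,\bar v)(v^* )=\{u^*\in U^*\mid (u^*,-v^* )\in\widehat N((\bar u,\bar v),\mathrm{gph}\,G)\}$, where for a set $\Omega$ and $\bar w\in\Omega$, $\widehat N(\bar w,\Omega)=\{w^*\mid \limsup_{w\to\bar w,\,w\in\Omega}\frac{\langle w^*,w-\bar w\rangle}{\|w-\bar w\|}\le 0\}$. $\nabla_pf(\bar p,\bar x)^*$ and $\nabla_xf(\bar p,\bar x)^*$ are the adjoints of the partial derivatives. $F:P\rightrightarrows Y$ is the objective map $F(p)=\{y\in Y\mid \exists x\in C(p),\ y=f(p,x)\}$. For nonempty $A\subseteq Y$, $\mathrm{Min}_KA=\{a\in A\mid (A-a)\cap(-K\setminus\{0\})=\emptyset\}$. $\mathcal F(p)=\mathrm{Min}_KF(p)$ is the perturbation map (with $\mathcal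 F(p)=\emptyset$ if $F(p)=\emptyset$) and $\mathcal S(p)=\{x\in C(p)\mid f(p,x)\in\mathcal F(p)\}$ is the solution map. $F$ is $K$-dominated by $\mathcal F$ near $\bar p$ if $F(p)\subseteq\mathcal F(p)+K$ for all $p$ in some neighborhood of $\bar p$. The contingent cone of $\Omega$ at $\bar w\in\mathrm{cl}\,\Omega$ is $T(\bar w,\Omega)=\{w\mid \exists\tau_k\downarrow0,\ \exists w_k\to w,\ \bar w+\tau_kw_k\in\Omega\ \forall k\}$. $C$ satisfies (ACQ) at $(\bar p,\bar x)\in\mathrm{gph}\,C$ if $$T((\bar p,\bar x),\mathrm{gph}\,C)\supset\{d\in P\times X\mid \langle\nabla g_i(\bar p,\bar x),d\rangle\le0\ \text{for } i\in I(\bar p,\bar x),\ \langle\nabla g_i(\bar p,\bar x),d\rangle=0\ \text{for } i=m+1,\dots,m+r\},$$ where $I(\bar p,\bar x)=\{i\in\{1,\dots,m\}\mid g_i(\bar p,\bar x)=0\}$. *)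

(* Defs.v *)
From mathcomp Require Import all_boot all_order all_algebra.
From mathcomp Require Import all_classical all_reals all_analysis.
Set Implicit Arguments.
Unset Strict Implicit.
Unset Printing Implicit Defensive.
Import Order.TTheory GRing.Theory Num.Theory.
Import numFieldNormedType.Exports.

Local Open Scope classical_set_scope.
Local Open Scope ring_scope.

(* A set-valued map from U to V is a function U -> set V. *)

Definition svdom (U V : Type) (G : U -> set V) : set U := [set u | G u !=set0].

Definition gph (U V : Type) (G : U -> set V) : set (U * V) :=
  [set w | G w.1 w.2].

Definition rge (U V : Type) (G : U -> set V) : set V := \bigcup_u G u.

Definition sv_of_fun (U V : Type) (f : U -> V) : U -> set V :=
  fun u => [set f u].

Definition set_add (V : zmodType) (A B : set V) : set V :=
  [set a + b | a in A & b in B].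

Definition set_sub (V : zmodType) (A B : set V) : set V :=
  [set a - b | a in A & b in B].

Definition cone_hull (R : realType) (V : lmodType R) (Omega : set V) : set V :=
  [set w | exists l a, [/\ 0 <= l, Omega a & w = l *: a]].

Definition closed_subspace (R : realType) (V : normedModType R) (A : set V) :=
  closed A /\ submod_closed [pred v | v \in A].

Definition is_cone (R : realType) (V : lmodType R) (K : set V) :=
  K 0 /\ forall l k, 0 <= l -> K k -> K (l *: k).

Definition pointed (V : zmodType) (K : set V) :=
  K `&` [set - k | k in K] = [set 0].

Definition profile (U : Type) (V : zmodType) (K : set V) (G : U -> set V) :
  U -> set V := fun u => set_add (G u) K.

Definition epi (U : Type) (V : zmodType) (K : set V) (G : U -> set V) :
  set (U * V) := [set w | set_add (G w.1) K w.2].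

(* The dual space is carried by plain functions, so that its vector operations
   are pointwise. *)
Definition dual (R : realType) (U : normedModType R) : set (U -> R) :=
  [set l : U -> R | scalar l /\ continuous l].

Definition dual_cone (R : realType) (Y : normedModType R) (K : set Y) :
  set (Y -> R) := [set l : Y -> R | dual l /\ forall k, K k -> 0 <= l k].

(* The identification of U^* x V^* with (U x V)^*. *)
Definition pairing (R : realType) (U V : Type) (u : U -> R) (v : V -> R) :
  U * V -> R := fun w => u w.1 + v w.2.

Definition normal_cone (R : realType) (W : normedModType R) (w0 : W)
    (Omega : set W) : set (W -> R) :=
  [set l : W -> R | dual l /\ forall w, Omega w -> l (w - w0) <= 0].

Definition coderivative (R : realType) (U V : normedModType R)
    (G : U -> set V) (w0 : U * V) (v : V -> R) : set (U -> R) :=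
  [set u | normal_cone w0 (gph G) (pairing u (fun y => - v y))].

(* The library's norm on a product is the maximum norm. The sum norm is
   equivalent to it, so that convergence, continuous functionals and
   derivatives on a product do not depend on the choice. *)
Definition sum_norm (R : realType) (U V : normedModType R) (w : U * V) : R :=
  `|w.1| + `|w.2|.

(* The upper limit is along the punctured neighbourhoods of w0 traced on Omega;
   it is -oo when w0 is isolated in Omega. *)
Definition frechet_normal_cone (R : realType) (U V : normedModType R)
    (w0 : U * V) (Omega : set (U * V)) : set (U * V -> R) :=
  [set l : U * V -> R | dual l /\
    (limf_esup (fun w : U * V => (l (w - w0) / sum_norm (w - w0))%:E)
       (within Omega w0^') <= 0)%E].

Definition frechet_coderivative (R : realType) (U V : normedModType R)
    (G : U -> set V) (w0 : U * V) (v : V -> R) : set (U -> R) :=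
  [set u | frechet_normal_cone w0 (gph G) (pairing u (fun y => - v y))].

Definition contingent_cone (R : realType) (W : normedModType R) (w0 : W)
    (Omega : set W) : set W :=
  [set w | exists (tau : nat -> R) (d : nat -> W),
    [/\ forall k, 0 < tau k, tau @ \oo --> (0 : R), d @ \oo --> w &
        forall k, Omega (w0 + tau k *: d k)]].

(* Differentiability near w0 and continuity of the derivative at w0 for the
   operator norm. *)
Definition continuously_differentiable_at (R : realType)
    (U V : normedModType R) (f : U -> V) (w0 : U) :=
  (\forall w \near w0, differentiable f w) /\
  forall e : R, 0 < e ->
    \forall w \near w0, forall h, `|'d f w h - 'd f w0 h| <= e * `|h|.

Definition partial1 (R : realType) (P X Y : normedModType R) (f : P * X -> Y)
  (w : P * X) : P -> Y := 'd (fun p : P => f (p, w.2)) (w.1).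

Definition partial2 (R : realType) (P X Y : normedModType R) (f : P * X -> Y)
  (w : P * X) : X -> Y := 'd (fun x : X => f (w.1, x)) (w.2).

Definition adjoint (U V S : Type) (A : U -> V) (v : V -> S) : U -> S := v \o A.

Definition objective_map (P X Y : Type) (f : P * X -> Y) (C : P -> set X) :
  P -> set Y := fun p => [set y | exists2 x, C p x & y = f (p, x)].

Definition Min (Y : zmodType) (K A : set Y) : set Y :=
  [set a | A a /\
    [set b - a | b in A] `&` ([set - k | k in K] `\ 0) = set0].

Definition perturbation_map (P X : Type) (Y : zmodType) (K : set Y)
    (f : P * X -> Y) (C : P -> set X) : P -> set Y :=
  fun p => Min K (objective_map f C p).

Definition solution_map (P X : Type) (Y : zmodType) (K : set Y)
    (f : P * X -> Y) (C : P -> set X) : P -> set X :=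
  fun p => [set x | C p x /\ perturbation_map K f C p (f (p, x))].

Definition dominated_near (P : topologicalType) (Y : zmodType) (K : set Y)
    (F M : P -> set Y) (p0 : P) :=
  \forall p \near p0, F p `<=` set_add (M p) K.

(* The first m constraints are inequalities, the last r are equalities. *)
Definition constraint_map (R : realType) (P X : Type) (m r : nat)
    (g : 'I_(m + r) -> P * X -> R) : P -> set X :=
  fun p => [set x |
    (forall i : 'I_(m + r), (i < m)%N -> g i (p, x) <= 0) /\
    (forall i : 'I_(m + r), (m <= i)%N -> g i (p, x) = 0)].

Definition ACQ (R : realType) (P X : normedModType R) (m r : nat)
    (g : 'I_(m + r) -> P * X -> R) (C : P -> set X) (w0 : P * X) :=
  [set d : P * X |
    (forall i : 'I_(m + r), (i < m)%N -> g i w0 = 0 -> 'd (g i) w0 d <= 0) /\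
    (forall i : 'I_(m + r), (m <= i)%N -> 'd (g i) w0 d = 0)]
  `<=` contingent_cone w0 (gph C).

Definition multipliers (R : realType) (P X : normedModType R) (m r : nat)
    (g : 'I_(m + r) -> P * X -> R) (w0 : P * X) (x : X -> R) :
    set 'rV[R]_(m + r) :=
  [set lam : 'rV[R]_(m + r) |
    (forall h, - x h = \sum_i lam 0 i * partial2 (g i) w0 h) /\
    (forall i : 'I_(m + r), (i < m)%N ->
       0 <= lam 0 i /\ lam 0 i * g i w0 = 0)].

(* Main.v *)
Require Import Defs.
From HB Require Import structures.
From mathcomp Require Import all_boot all_order all_algebra.
From mathcomp Require Import all_classical all_reals all_analysis.
From mathcomp Require Import ring lra.
Set Implicit Arguments.
Unset Strict Implicit.
Unset Printing Implicit Defensive.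
Import Order.TTheory GRing.Theory Num.Theory.
Import numFieldNormedType.Exports.

Local Open Scope classical_set_scope.
Local Open Scope ring_scope.

(** Since the objective map is dominated by the perturbation map near the
    reference parameter, adding K to either of them gives the same graph near
    the reference point. For the objective map F this graph is the projection of
    the intersection of epi f with gph C times Y, hence convex, and Frechet
    normals to a convex set are the normals of convex analysis. So u belongs to
    the Frechet coderivative at v exactly when
      u (p - pbar) <= v (y - ybar)   for all x in C p and y in f (p, x) + K.

    The heart of the proof is a sum rule that splits this inequality: there is a
    continuous linear q on P * X with
      q (w - wbar) <= v (y - ybar)       for all (w, y) in epi f, and
      u (p - pbar) <= q (w - wbar)       for all w = (p, x) in gph C.
    The first line says that q is in the coderivative of f + K, the second that
    n = u o fst - q is normal to gph C. The functional q comes from the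
    Hahn-Banach theorem, applied to a convex set of the product of P * X with
    the real line. Its continuity is where completeness enters: f is defined
    everywhere and epi f is closed and convex, so the argument of the open
    mapping theorem (Baire category, then a dyadic series) finds a ball over
    which epi f contains points of bounded height, and q is bounded above on
    that ball.

    Under the Abadie condition n is nonpositive on the linearized cone, and
    the algebraic form of Farkas' lemma writes n as a combination of the
    gradients of the constraints. Reading q + n = u o fst on P and on X
    separately gives the formula. The reverse inclusion rests on the convexity
    of the constraints and of gph C: a combination of the gradients with
    admissible multipliers is normal to gph C. When f is differentiable, its convexity along
    K leaves v o 'd f as the only element of the coderivative of f + K. *)

(** * Convexity in terms of scalars and segments *)

Lemma convex_setP (R : realType) (V : lmodType R) (A : set V) :
  convex_set A <->
  forall x y (t : R), 0 <= t <= 1 -> A x -> A y -> A (t *: x + (1 - t) *: y).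
Proof.
split=> [cA x y t t01 Ax Ay|cA x y t]; last first.
  rewrite !inE => Ax Ay.
  have t01 : 0 <= t%:num <= 1 by rewrite ge0 le1.
  exact: (cA x y t%:num t01 Ax Ay).
have/andP[t0 t1] := t01.
pose s : {i01 R} := Itv01 t0 t1.
have := cA x y s; rewrite !inE; exact.
Qed.

Lemma convex_segment (R : realType) (V : lmodType R) (A : set V) u v (t : R) :
  convex_set A -> A u -> A v -> 0 <= t <= 1 -> A (u + t *: (v - u)).
Proof.
move=> /convex_setP cA Au Av t01; have := cA _ _ _ t01 Av Au.
by rewrite scalerBl scale1r scalerBr addrCA.
Qed.

Lemma convex_function_segment (R : realType) (V : lmodType R) (g : V -> R) u v t :
  convex_function setT g -> 0 <= t <= 1 ->
  g (u + t *: (v - u)) - g u <= t * (g v - g u).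
Proof.
move=> cg /andP[t0 t1].
have := cg (Itv01 t0 t1) v u (in_setT _) (in_setT _).
have -> : conv (Itv01 t0 t1) (v : convex_lmodType V) u = u + t *: (v - u).
  rewrite -[LHS]/(t *: v + (1 - t) *: u).
  by rewrite scalerBl scale1r scalerBr addrCA.
rewrite -[leRHS]/(t * g v + (1 - t) * g u) => ?; lra.
Qed.

Lemma convex_cone_add (R : realType) (Y : lmodType R) (K : set Y) k k' :
  is_cone K -> convex_set K -> K k -> K k' -> K (k + k').
Proof.
move=> [_ coneK] /convex_setP cK Kk Kk'.
have h01 : 0 <= (2^-1 : R) <= 1 by lra.
have := coneK 2 _ (ler0n _ 2) (cK _ _ _ h01 Kk Kk').
by rewrite (_ : 1 - 2^-1 = 2^-1 :> R) ?scalerDr ?scalerA ?mulfV ?scale1r//; lra.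
Qed.

(** * Continuous linear functionals *)

Lemma scalar_bundle (R : pzRingType) (V : lmodType R) (l : V -> R) :
  scalar l -> exists L : {scalar V}, l = L.
Proof.
move=> lin.
pose linM := GRing.isLinear.Build _ _ _ _ _ lin.
pose L : {scalar V} := HB.pack l linM.
by exists L.
Qed.

Lemma prod_split (U V : nmodType) (u : U) (v : V) : (u, v) = (u, 0) + (0, v).
Proof. by congr pair; rewrite /= ?addr0 ?add0r. Qed.

Lemma dual0 (R : realType) (U : normedModType R) (u : U -> R) : dual u -> u 0 = 0.
Proof. by move=> [/scalar_bundle[L ->] _]; rewrite linear0. Qed.

Lemma dualN (R : realType) (U : normedModType R) (u : U -> R) :
  dual u -> dual (fun x => - u x).
Proof.
move=> [lu cu]; split; last by move=> x; apply: continuousN; exact: cu.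
by move=> a x y; rewrite lu opprD mulrN.
Qed.

Lemma dual_diff (R : realType) (U : normedModType R) (g : U -> R) x :
  differentiable g x -> dual ('d g x : U -> R).
Proof. by move=> dg; split; [exact: linearP|exact: diff_continuous]. Qed.

Lemma dual_lin_comb (R : realType) (U : normedModType R) (I : finType)
    (c : I -> R) (l : I -> U -> R) :
  (forall i, dual (l i)) -> dual (fun x => \sum_i c i * l i x).
Proof.
move=> dl; split=> [a x y|x].
  rewrite mulr_sumr -big_split/=; apply: eq_bigr => i _.
  by rewrite (dl i).1 mulrDr mulrCA.
apply: cvg_big => [|i _]; first exact: add_continuous.
by apply: cvgM; [exact: cvg_cst|exact: (dl i).2].
Qed.

Lemma dual_pairing (R : realType) (U V : normedModType R) (u : U -> R) (v : V -> R) :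
  dual u -> dual v -> dual (pairing u v).
Proof.
move=> [lu cu] [lv cv]; split.
  by move=> a w z; rewrite /pairing/= lu lv mulrDr addrACA.
move=> w; apply: (@continuousD _ _ _ (u \o fst) (v \o snd));
  apply: continuous_comp; [exact: cvg_fst|exact: cu|exact: cvg_snd|exact: cv].
Qed.

(** A pairing of two functions can be linear without either of them being so,
    because a constant may be moved from one to the other; fixing the value at 0
    excludes this. *)
Lemma dual_pairing_fst (R : realType) (U V : normedModType R) (u : U -> R) (v : V -> R) :
  dual (pairing u v) -> v 0 = 0 -> dual u.
Proof.
move=> [luv cuv] v0.
have -> : u = pairing u v \o (fun h => (h, 0)).
  by apply/funext => h; rewrite /pairing/= v0 addr0.
split=> [a h k|h]; last first.
  by apply: continuous_comp; [exact: cvg_pair cvg_id (cvg_cst _)|exact: cuv].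
by rewrite /= -luv; congr pairing; congr pair; rewrite /= scaler0 addr0.
Qed.

Lemma dual_pairing_snd (R : realType) (U V : normedModType R) (u : U -> R) (v : V -> R) :
  dual (pairing u v) -> u 0 = 0 -> dual v.
Proof.
move=> [luv cuv] u0.
have -> : v = pairing u v \o (fun h => (0, h)).
  by apply/funext => h; rewrite /pairing/= u0 add0r.
split=> [a h k|h]; last first.
  by apply: continuous_comp; [exact: cvg_pair (cvg_cst _) cvg_id|exact: cuv].
by rewrite /= -luv; congr pairing; congr pair; rewrite /= scaler0 addr0.
Qed.

(** By linearity the bound above on a ball around w0 becomes a bound above on a
    ball around 0, and symmetry of that ball makes it two-sided. *)
Lemma linear_bounded_above_continuous (R : realType) (W : normedModType R)
    (l : {scalar W}) (w0 : W) (rho M : R) :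
  0 < rho -> (forall w, ball w0 rho w -> l w <= M) -> continuous (l : W -> R).
Proof.
move=> rho0 lM; apply: bounded_linear_continuous; apply/ex_bound.
have up h : `|h| < rho -> l h <= M - l w0.
  move=> hr; rewrite lerBrDl -linearD; apply: lM.
  by rewrite -ball_normE /ball_/= opprD addNKr normrN.
exists (M - l w0); apply/nbhs_norm0P; exists rho => //= h /= hr.
by rewrite ler_norml up// andbT lerNl -linearN up// normrN.
Qed.

Lemma dual_norm_bound (R : realType) (Y : normedModType R) (l : {scalar Y}) (M : R) :
  continuous (l : Y -> R) -> exists B : R, forall y, `|y| <= M -> l y <= B.
Proof.
move=> /linear_bounded_continuous/bounded_funP/(_ M)[B lB].
by exists B => y /lB; apply: le_trans; exact: ler_norm.
Qed.

(** * A Hahn-Banach theorem for convex sets *)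

(** One step of the extension: a linear functional, given by its graph G, lies
    below E and is to be continued to the line spanned by x with value a at x.
    For s < 0 the condition bounds a from below by the elements of the set L of
    the proof, for s > 0 from above. A point of E on each side has a convex
    combination that lies over the domain of G, and comparing it with G shows
    that every lower bound is at most every upper bound; so sup L is a possible
    value. *)
Lemma convex_extension_constant (R : realType) (V : lmodType R)
    (E G : set (V * R)) (x : V) :
  convex_set E -> (forall v, exists y, E (v, y)) -> G (0, 0) ->
  (forall a u v, G u -> G v -> G (a *: u + v)) ->
  (forall v r y, G (v, r) -> E (v, y) -> r <= y) ->
  exists a : R, forall v r s y, G (v, r) -> E (v + s *: x, y) -> r + s * a <= y.
Proof.
move=> /convex_setP cE domE G0 Glin GE.
pose L := [set b : R | exists v r t y,
  [/\ 0 < t, G (v, r), E (v - t *: x, y) & b = (r - y) / t]].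
have LU b v r s y : L b -> 0 < s -> G (v, r) -> E (v + s *: x, y) ->
    b <= (y - r) / s.
  move=> [v' [r' [t [y' [t0 G' E' ->]]]]] s0 Gv Ev.
  have st0 : 0 < s + t by rewrite addr_gt0.
  rewrite ler_pdivrMr// mulrAC ler_pdivlMr//.
  (* The weights for which the multiples of x cancel. *)
  have lam : 0 <= s / (s + t) <= 1.
    apply/andP; split; first by apply: divr_ge0; apply: ltW.
    by rewrite ler_pdivrMr// mul1r lerDl ltW.
  have lamE : 1 - s / (s + t) = t / (s + t) by field; rewrite gt_eqF.
  have Ec := cE _ _ _ lam E' Ev.
  have Gc : G ((s / (s + t)) *: (v', r') + (t / (s + t)) *: (v, r)).
    apply: (Glin) => //.
    by rewrite -[X in G X]addr0; apply: Glin.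
  rewrite lamE in Ec.
  have eqv : s / (s + t) *: (v' - t *: x) + t / (s + t) *: (v + s *: x) =
     s / (s + t) *: v' + t / (s + t) *: v.
    rewrite !scalerDr scalerN !scalerA addrACA.
    rewrite (_ : t / (s + t) * s = s / (s + t) * t); last by ring.
    by rewrite addNr addr0.
  have := GE _ _ _ Gc; rewrite /= -eqv => /(_ _ Ec).
  rewrite /GRing.scale/=.
  have -> : s / (s + t) * r' + t / (s + t) * r = (s * r' + t * r) / (s + t) by ring.
  have -> : s / (s + t) * y' + t / (s + t) * y = (s * y' + t * y) / (s + t) by ring.
  rewrite ler_pM2r ?invr_gt0// => le1; lra.
have [y1 Ey1] := domE (0 + 1 *: x).
have [y2 Ey2] := domE (0 - 1 *: x).
have L0 : L !=set0.
  exists ((0 - y2) / 1); exists 0, 0, 1, y2; split => //.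
have ubL : has_ubound L.
  by exists ((y1 - 0) / 1) => b Lb; apply: LU Lb ltr01 G0 Ey1.
exists (sup L) => v r s y Gv Ev.
have [s0|s0|s0] := ltgtP s 0.
- have : (r - y) / (- s) <= sup L.
    apply: ub_le_sup => //; exists v, r, (- s), y; split => //.
      by rewrite oppr_gt0.
    by rewrite scaleNr opprK.
  rewrite ler_pdivrMr ?oppr_gt0// mulrN => ?; lra.
- have : sup L <= (y - r) / s by apply: sup_le_ub => // b Lb; apply: LU Lb s0 Gv Ev.
  by rewrite ler_pdivlMr// => ?; lra.
- by move: Ev; rewrite s0 scale0r addr0 mul0r addr0; exact: GE.
Qed.

(** Convexity of E replaces the sublinearity of the usual dominating function,
    and a set E, unlike the function v |-> inf (E v), needs no finite infima.
    A maximal linear relation below E is found by Zorn's lemma. It is the graph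
    of a function: a nonzero value over 0 could be scaled beyond any element of
    E over 0. *)
Theorem hahn_banach_convex (R : realType) (V : lmodType R) (E : set (V * R)) :
  convex_set E -> (forall v, exists y, E (v, y)) ->
  (forall y, E (0, y) -> 0 <= y) ->
  exists l : V -> R, scalar l /\ forall v y, E (v, y) -> l v <= y.
Proof.
move=> cE domE E0.
pose good (G : set (V * R)) :=
  (forall a u v, G u -> G v -> G (a *: u + v)) /\
  (forall v r y, G (v, r) -> E (v, y) -> r <= y).
have [|G [[Glin GE] Gmax]] := @Zorn_bigcup _ good.
  move=> F Fgood Ftot; split.
    move=> a u v [A FA Au] [B FB Bv].
    have [AB|BA] := Ftot _ _ FA FB.
      by exists B => //; apply: (Fgood _ FB).1 => //; apply: AB.
    by exists A => //; apply: (Fgood _ FA).1 => //; apply: BA.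
  by move=> v r y [A FA Avr]; apply: (Fgood _ FA).2.
(* The empty set is good, so the maximal element has to be shown nonempty. *)
have G0 : G (0, 0).
  apply: contrapT => nG0.
  have G_empty u : ~ G u.
    move=> Gu; apply: nG0; have := Glin (-1) _ _ Gu Gu.
    by rewrite scaleN1r addNr.
  apply: (Gmax [set 0]).
    split; last by move=> sub; apply: nG0; apply: sub.
    by move=> u /G_empty.
  split=> [a u v -> -> /=|v r y /= [-> ->]]; last exact: E0.
  by rewrite scaler0 addr0.
have Gtot x : exists r, G (x, r).
  apply: contrapT => nGx.
  have [a Ha] := convex_extension_constant x cE domE G0 Glin GE.
  pose G' := [set u : V * R | exists v r s,
    G (v, r) /\ u = (v + s *: x, r + s * a)].
  apply: (Gmax G').
    split.
      move=> [v r] Gvr; exists v, r, 0; split => //.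
      by rewrite scale0r mul0r !addr0.
    move=> sub; apply: nGx; exists a; apply: sub.
    by exists 0, 0, 1; split => //; rewrite scale1r mul1r !add0r.
  split.
    move=> c _ _ [v [r [s [Gv ->]]]] [v' [r' [s' [Gv' ->]]]].
    exists (c *: v + v'), (c * r + r'), (c * s + s'); split.
      exact: (Glin c _ _ Gv Gv').
    congr (_, _) => /=.
      by rewrite scalerDr scalerDl scalerA addrACA.
    by rewrite /GRing.scale /= mulrDr mulrDl mulrA addrACA.
  by move=> _ _ y [v [r [s [Gv [-> ->]]]]]; apply: Ha.
have Gfun x r r' : G (x, r) -> G (x, r') -> r = r'.
  move=> Gr Gr'; have := Glin (-1) _ _ Gr Gr'.
  rewrite scaleN1r => Gd.
  have [y Ey] := domE 0.
  have key c : c * (r' - r) <= y.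
    have := Glin c _ _ Gd G0; rewrite addr0 => Gc.
    apply: (GE 0) Ey; move: Gc; congr G; congr (_, _) => /=.
      by rewrite addNr scaler0.
    by rewrite /GRing.scale /= [- r + _]addrC.
  apply: contrapT => /eqP; rewrite eq_sym -subr_eq0 => d0.
  (* Scaled so that the value over 0 is y + 1, above E. *)
  have := key ((y + 1) / (r' - r)); rewrite divfK// => ?; lra.
have [l Gl] := choice Gtot.
exists l; split => [c u v|v y]; last by apply: GE.
by apply: Gfun (Gl _) _; apply: (Glin c _ _ (Gl u) (Gl v)).
Qed.

(** * Farkas' lemma with inequalities and equalities *)

(** Induction on the number of functionals, after Bartl. If the functionals
    other than the first do not yet force b to be nonpositive, there is x that
    satisfies their constraints with b x > 0, so the constraint of the first
    functional a0 fails at x. Projecting along x onto the kernel of a0 reduces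
    the claim to the other functionals; the coefficient of a0 is then read off
    at x. If a0 is an inequality constraint, then a0 x > 0, and this coefficient
    is nonnegative since b x > 0 while the other terms are nonpositive at x. *)
Lemma mixed_farkas (R : realFieldType) (V : lmodType R) (n : nat)
    (ineq eqn : 'I_n -> bool) (a : 'I_n -> {scalar V}) (b : {scalar V}) :
  (forall d, (forall i, ineq i -> a i d <= 0) ->
             (forall i, eqn i -> a i d = 0) -> b d <= 0) ->
  exists lam : 'I_n -> R,
    [/\ forall d, b d = \sum_i lam i * a i d,
        forall i, ~~ eqn i -> 0 <= lam i &
        forall i, ~~ ineq i -> ~~ eqn i -> lam i = 0].
Proof.
elim: n ineq eqn a b => [|n IH] ineq eqn a b neg.
  have b_le0 x : b x <= 0 by apply: neg => -[].
  exists (fun=> 0); split=> // d; rewrite big_ord0.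
  by apply/le_anti; rewrite b_le0/= -oppr_le0 -linearN.
pose cons (c : R) (mu : 'I_n -> R) i := if unlift ord0 i is Some j then mu j else c.
have consP c mu : (forall d, b d = c * a ord0 d + \sum_j mu j * a (lift ord0 j) d) ->
    (~~ eqn ord0 -> 0 <= c) -> (~~ ineq ord0 -> ~~ eqn ord0 -> c = 0) ->
    (forall j, ~~ eqn (lift ord0 j) -> 0 <= mu j) ->
    (forall j, ~~ ineq (lift ord0 j) -> ~~ eqn (lift ord0 j) -> mu j = 0) ->
  exists lam : 'I_n.+1 -> R,
    [/\ forall d, b d = \sum_i lam i * a i d,
        forall i, ~~ eqn i -> 0 <= lam i &
        forall i, ~~ ineq i -> ~~ eqn i -> lam i = 0].
  move=> bE c_ge0 c0 mu_ge0 mu0; exists (cons c mu); split.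
  - move=> d; rewrite bE big_ord_recl {1}/cons unlift_none; congr (_ + _).
    by apply: eq_bigr => j _; rewrite /cons liftK.
  - by move=> i; rewrite /cons; case: unliftP => [j ->|->]; [exact: mu_ge0|].
  - by move=> i; rewrite /cons; case: unliftP => [j ->|->]; [exact: mu0|].
have [rest_neg|] := pselect (forall d,
    (forall j, ineq (lift ord0 j) -> a (lift ord0 j) d <= 0) ->
    (forall j, eqn (lift ord0 j) -> a (lift ord0 j) d = 0) -> b d <= 0).
  have [mu [bE mu_ge0 mu0]] := IH _ _ (fun j => a (lift ord0 j)) _ rest_neg.
  by apply: (consP 0 mu) => // d; rewrite mul0r add0r.
move=> /existsNP[x /not_implyP[xineq /not_implyP[xeqn /negP]]]; rewrite -ltNge => bx.
pose c := a ord0 x.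
have c_pos : ~~ eqn ord0 -> ineq ord0 /\ 0 < c.
  move=> neq0; apply: contrapT => nc; suff : b x <= 0 by rewrite leNgt bx.
  apply: neg => i; case: (unliftP ord0 i) => [j ->|->].
  - exact: xineq.
  - by move=> ineq0; rewrite leNgt; apply/negP => ?; apply: nc.
  - exact: xeqn.
  - by rewrite (negPf neq0).
have c_neq0 : c != 0.
  apply/eqP => c0; suff : b x <= 0 by rewrite leNgt bx.
  apply: neg => i; case: (unliftP ord0 i) => [j ->|->]; rewrite -/c ?c0//.
  - exact: xineq.
  - exact: xeqn.
(* The projection along x onto the kernel of the first functional. *)
pose proj (d : V) := d - (a ord0 d / c) *: x.
have proj_lin (l : {scalar V}) : scalar (fun d => l (proj d)).
  move=> k u v; rewrite /proj !linearB !linearZ/= !linearP/=.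
  by rewrite /GRing.scale/=; field.
have /choice[a' a'E] j : exists L : {scalar V}, forall d, L d = a (lift ord0 j) (proj d).
  by have [L LE] := scalar_bundle (proj_lin (a (lift ord0 j))); exists L; rewrite -LE.
have [b' b'E] : exists L : {scalar V}, forall d, L d = b (proj d).
  by have [L LE] := scalar_bundle (proj_lin b); exists L; rewrite -LE.
have proj0 d : a ord0 (proj d) = 0.
  by rewrite /proj linearB linearZ/= -/c divfK// subrr.
have [d dineq deqn|mu [bE mu_ge0 mu0]] :=
  IH (ineq \o lift ord0) (eqn \o lift ord0) a' b'.
  rewrite b'E; apply: neg => i; case: (unliftP ord0 i) => [j ->|->];
    rewrite ?proj0//.
  - by move=> /= ?; rewrite -a'E dineq.
  - by move=> /= ?; rewrite -a'E deqn.
apply: (consP ((b x - \sum_j mu j * a (lift ord0 j) x) / c) mu) => //.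
- move=> d; have := bE d; rewrite b'E {1}/proj linearB linearZ/=.
  move/eqP; rewrite subr_eq => /eqP ->.
  under eq_bigr do rewrite a'E /proj linearB linearZ/= mulrBr.
  rewrite sumrB.
  under [X in _ - X]eq_bigr do rewrite mulrCA.
  by rewrite -mulr_sumr; field.
- move=> neq0; have [_ c0] := c_pos neq0.
  rewrite divr_ge0 ?(ltW c0)// subr_ge0 (le_trans _ (ltW bx))//.
  apply: sumr_le0 => j _; case: (boolP (eqn (lift ord0 j))) => [ej|nej].
    by rewrite xeqn// mulr0.
  case: (boolP (ineq (lift ord0 j))) => [ij|nij].
    by rewrite mulr_ge0_le0 ?mu_ge0 ?xineq.
  by rewrite mu0// mul0r.
- by move=> nineq neq0; have [] := c_pos neq0; rewrite (negPf nineq).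
Qed.

(** * Bounded selections of closed convex graphs *)

(* Convergence of a filter is stated over pointed spaces. *)
HB.instance Definition _ (U V : completeType) := Pointed.on (U * V)%type.

Lemma prod_cauchy_cvg (U V : completeType) (F : set_system (U * V)) :
  ProperFilter F -> cauchy F -> cvg F.
Proof.
move=> FF Fc.
have /cauchy_cvg cU : cauchy (fst @ F).
  move=> A entA.
  have [|[B1 B2] /= [FB1 FB2] sub] := Fc [set xy | A (xy.1.1, xy.2.1)].
    exists (A, setT); first by split => //; exact: entourageT.
    by move=> [[a b] [c d]] /= [? _]; exists ((a, c), (b, d)).
  exists ([set x | exists y, B1 (x, y)], [set x | exists y, B2 (x, y)]).
    split; [apply: filterS FB1|apply: filterS FB2];
    by move=> [x y] Bxy; exists y.
  move=> [x x'] /= [[y Bxy] [y' Bxy']].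
  exact: (sub ((x, y), (x', y'))).
have /cauchy_cvg cV : cauchy (snd @ F).
  move=> A entA.
  have [|[B1 B2] /= [FB1 FB2] sub] := Fc [set xy | A (xy.1.2, xy.2.2)].
    exists (setT, A); first by split => //; exact: entourageT.
    by move=> [[a b] [c d]] /= [_ ?]; exists ((a, c), (b, d)).
  exists ([set y | exists x, B1 (x, y)], [set y | exists x, B2 (x, y)]).
    split; [apply: filterS FB1|apply: filterS FB2];
    by move=> [x y] Bxy; exists x.
  move=> [y y'] /= [[x Bxy] [x' Bxy']].
  exact: (sub ((x, y), (x', y'))).
apply/cvg_ex; exists (lim (fst @ F), lim (snd @ F)).
move=> A [[B1 B2] /= [/cU FB1 /cV FB2] sub].
have FB : F ((fst @^-1` B1) `&` (snd @^-1` B2)) by exact: filterI.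
by apply: (@filterS _ F _ _ _ _ FB) => -[x y] xy; apply: sub.
Qed.

HB.instance Definition _ (U V : completeType) :=
  Uniform_isComplete.Build (U * V)%type (@prod_cauchy_cvg U V).

HB.instance Definition _ (R : realType) (U V : completeNormedModType R) :=
  Complete.on (U * V)%type.

(** The sets of points over which E has an element of norm at most n cover W, so
    by Baire's theorem one of them is dense in some ball. *)
Lemma bounded_selection_dense (R : realType) (W Y : completeNormedModType R)
    (E : set (W * Y)) :
  (forall w, exists y, E (w, y)) ->
  exists (w1 : W) (rho M : R), 0 < rho /\
    ball w1 rho `<=` closure [set w | exists2 y, E (w, y) & `|y| <= M].
Proof.
move=> domE.
pose D (n : nat) := [set w | exists2 y, E (w, y) & `|y| <= n%:R].
have [n ndense] : exists n, ~ dense (~` closure (D n)).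
  apply: contrapT => /forallNP alldense.
  have /Baire : forall n, open (~` closure (D n)) /\ dense (~` closure (D n)).
    move=> n; split; first exact/closed_openC/closed_closure.
    exact: contrapT (alldense n).
  move=> /(_ setT) [|//|w [_ Dw]].
  - by exists 0.
  - exact: openT.
  have [y Ewy] := domE w.
  apply: (Dw (Num.bound `|y|) I); apply: subset_closure; exists y => //.
  by apply: ltW; apply: archi_boundP.
move: ndense => /existsNP[U /not_implyP[[w1 Uw1] /not_implyP[openU UD]]].
have /nbhs_ballP[rho rho0 rhoU] : nbhs w1 U by exact: open_nbhs_nbhs.
exists w1, rho, n%:R; split=> // w /rhoU Uw.
by apply: contrapT => Dw; apply: UD; exists w.
Qed.

(** Density in the ball improves to the whole ball. From w choose a point a of
    the dense set so close to w that w' = 2 w - a is still in the ball, so that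
    w is the midpoint of a and w', and continue with w'. Unfolding the midpoints
    N times gives a convex combination (the sequence e of the proof) of points
    of E, whose first component tends to w at rate 2^-N, and whose second
    component stays bounded by M and is a Cauchy sequence; closedness of E then
    puts the limit in E. *)
Lemma bounded_selection_ball (R : realType) (W : normedModType R)
    (Y : completeNormedModType R) (E : set (W * Y)) (w1 : W) (rho M : R) :
  closed E -> convex_set E ->
  ball w1 rho `<=` closure [set w | exists2 y, E (w, y) & `|y| <= M] ->
  forall w, ball w1 rho w -> exists2 y, E (w, y) & `|y| <= M.
Proof.
move=> clE /convex_setP cE dE.
have /choice[s sP] : forall w, exists u : W * Y, ball w1 rho w ->
    [/\ E u, `|u.2| <= M & `|w - u.1| < rho - `|w - w1|].
  move=> w; have [Bw|nBw] := pselect (ball w1 rho w); last by exists 0.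
  have r0 : 0 < rho - `|w - w1|.
    by move: Bw; rewrite -ball_normE /ball_/= distrC subr_gt0.
  have [a [[y Eay yM]]] := dE _ Bw _ (nbhsx_ballx w _ r0).
  by rewrite -ball_normE /ball_/= => ?; exists (a, y).
(* The reflection of w through the point chosen near it. *)
pose next w := 2 *: w - (s w).1.
have next_ball w : ball w1 rho w -> ball w1 rho (next w).
  move=> Bw; have [_ _ ws] := sP _ Bw.
  rewrite -ball_normE /ball_/= distrC /next.
  have -> : 2 *: w - (s w).1 - w1 = (w - (s w).1) + (w - w1).
    by rewrite scaler_nat mulr2n addrACA addrA.
  by rewrite (le_lt_trans (ler_normD _ _))// -ltrBrDr.
pose fix e (N : nat) (w : W) {struct N} : W * Y := if N is N'.+1 then
  (2^-1 : R) *: s w + (1 - 2^-1 : R) *: e N' (next w) else s w.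
have half : 1 - 2^-1 = 2^-1 :> R by lra.
have eE N : forall w, ball w1 rho w -> E (e N w) /\ `|(e N w).2| <= M.
  elim: N => [|N IH] w Bw /=; first by have [] := sP _ Bw.
  have [Es sM _] := sP _ Bw; have [Ee eM] := IH _ (next_ball _ Bw).
  split; first by apply: cE => //; lra.
  rewrite half (le_trans (ler_normD _ _))// !normrZ gtr0_norm ?invr_gt0//.
  lra.
have rate1 N : forall w, ball w1 rho w -> `|(e N w).1 - w| <= 2^-1 ^+ N * rho.
  elim: N => [|N IH] w Bw.
    have [_ _ sw] := sP _ Bw; rewrite /= expr0 mul1r distrC ltW//.
    by rewrite (lt_le_trans sw)// gerBl.
  rewrite exprS -mulrA.
  have -> : (e N.+1 w).1 - w = 2^-1 *: ((e N (next w)).1 - next w).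
    rewrite /= half -scalerDr -[X in _ - X](scale1r w).
    rewrite -[X in X *: w](@mulVf _ 2)// -scalerA -scalerBr; congr (_ *: _).
    by rewrite /next opprB addrA [X in X = _]addrAC addrAC [(s w).1 + _]addrC.
  rewrite normrZ gtr0_norm ?invr_gt0// ler_pM2l ?invr_gt0//.
  exact/IH/next_ball.
have rate2 p N : forall w, ball w1 rho w ->
    `|(e N w).2 - (e (N + p)%N w).2| <= 2^-1 ^+ N * (M + M).
  elim: N => [|N IH] w Bw.
    rewrite expr0 mul1r (le_trans (ler_normB _ _))// lerD//.
      by have [] := eE 0%N _ Bw.
    by have [] := eE (0 + p)%N _ Bw.
  rewrite exprS -mulrA addSn /= half opprD addrACA subrr add0r -scalerBr.
  rewrite normrZ gtr0_norm ?invr_gt0// ler_pM2l ?invr_gt0//.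
  exact/IH/next_ball.
move=> w Bw.
have half0 c : (2^-1 ^+ N * c) @[N --> \oo] --> (0 : R).
  rewrite -[X in _ --> X](mul0r c); apply: cvgMl.
  by apply: cvg_expr; rewrite ger0_norm ?invr_ge0// invf_lt1// ltr1n.
have cw : (e N w).1 @[N --> \oo] --> w.
  apply/cvgrPdist_lt => eps eps0.
  have /cvgrPdist_lt/(_ _ eps0) := half0 rho.
  apply: filterS => N; rewrite sub0r normrN => lt_eps.
  rewrite distrC (le_lt_trans (rate1 _ _ Bw))//.
  exact: le_lt_trans (ler_norm _) lt_eps.
have /cauchy_cvg/cvg_ex[y cy] : cauchy ((e N w).2 @[N --> \oo]).
  apply/cauchy_exP => eps eps0.
  have /cvgrPdist_lt/(_ _ eps0) [N _ /(_ N (leqnn N))] := half0 (M + M).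
  rewrite sub0r normrN => lt_eps.
  exists (e N w).2; exists N => // k /= Nk.
  rewrite -ball_normE /ball_/= -(subnKC Nk) (le_lt_trans (rate2 _ _ _ Bw))//.
  exact: le_lt_trans (ler_norm _) lt_eps.
exists y; last first.
  apply: (closed_cvg _ (@closed_le R M) _ _ (cvg_norm cy)).
  by apply: nearW => N; have [] := eE N _ Bw.
apply: (@closed_cvg nat (W * Y)%type \oo _ _ E clE _ (w, y)); last first.
  exact: (cvg_pair cw cy).
by apply: nearW => N /=; have [] := eE N _ Bw; case: (e N w).
Qed.

(** * The sum rule *)

(** The set H of the proof plays the role of the infimal convolution of the
    support condition: a linear q below it satisfies
    q h <= v (y - y0) - n (c - w0) for all c in A and (c + h, y) in E. Taking
    c = w0 gives the inequality over E, and taking c + h = w0 and y = y0 gives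
    the one over A. The hypothesis on n says that H is nonnegative over 0. *)
Lemma convex_graph_sum_rule (R : realType) (W Y : completeNormedModType R)
    (E : set (W * Y)) (A : set W) (w0 : W) (y0 : Y)
    (n : {scalar W}) (v : {scalar Y}) :
  closed E -> convex_set E -> (forall w, exists y, E (w, y)) ->
  convex_set A -> A w0 -> E (w0, y0) -> continuous (v : Y -> R) ->
  (forall w y, A w -> E (w, y) -> n (w - w0) <= v (y - y0)) ->
  exists q : {scalar W}, [/\ continuous (q : W -> R),
    forall w y, E (w, y) -> q (w - w0) <= v (y - y0) &
    forall w, A w -> n (w - w0) <= q (w - w0)].
Proof.
move=> clE cE domE cA Aw0 E0 cv nv.
pose H := [set u : W * R | exists c y,
  [/\ A c, E (c + u.1, y) & u.2 = v (y - y0) - n (c - w0)]].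
have [||y [c [z [Ac Ecz /= ->]]]|q [qlin qH]] := @hahn_banach_convex _ _ H.
- apply/convex_setP => -[h r] [h' r'] t t01 [c [y [/= Ac Ey ->]]] [c' [y' [/= Ac' Ey' ->]]].
  exists (t *: c + (1 - t) *: c'), (t *: y + (1 - t) *: y'); split => /=.
  + exact: (convex_setP A).1.
  + have := (convex_setP E).1 cE _ _ _ t01 Ey Ey'; congr E; congr (_, _) => /=.
    by rewrite !scalerDr addrACA.
  + rewrite !linearB !linearD !linearZ/= /GRing.scale/=; ring.
- move=> h; have [y Ey] := domE (w0 + h).
  by exists (v (y - y0) - n (w0 - w0)), w0, y.
- by rewrite subr_ge0; apply: nv => //; rewrite addr0 in Ecz.
have [Q QE] := scalar_bundle qlin; subst q.
have qE w y : E (w, y) -> Q (w - w0) <= v (y - y0).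
  move=> Ewy; apply: qH; exists w0, y; split => //=; first by rewrite addrC subrK.
  by rewrite subrr linear0 subr0.
exists Q; split => //; last first.
  move=> w Aw; have : Q (w0 - w) <= v (y0 - y0) - n (w - w0).
    by apply: qH; exists w, y0; split => //=; rewrite addrC subrK.
  by rewrite subrr linear0 -opprB linearN; lra.
(* Continuity: Q is bounded above on a ball over which E has bounded selections. *)
have [w1 [rho [M [rho0 dE]]]] := bounded_selection_dense domE.
have [B vB] := dual_norm_bound M cv.
apply: (@linear_bounded_above_continuous _ _ _ w1 rho (B - v y0 + Q w0)) => //.
move=> w /(bounded_selection_ball clE cE dE)[y Ewy yM].
by have := qE _ _ Ewy; rewrite !linearB; have := vB _ yM; lra.
Qed.

(** * Directional estimates and partial derivatives *)

Lemma diff_ge (R : realType) (W : normedModType R) (g : W -> R) (w0 v : W) (s : R) :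
  differentiable g w0 ->
  (forall t, 0 < t <= 1 -> t * s <= g (w0 + t *: v) - g w0) -> s <= 'd g w0 v.
Proof.
move=> dg gs; rewrite -deriveE//.
have dgv : derivable g w0 v by exact: diff_derivable.
apply: (cvgr_to_ge (cvg_dnbhs_at_right dgv)).
near=> t.
have t0 : 0 < t by near: t; exact: nbhs_right_gt.
have t1 : t <= 1 by near: t; exact: nbhs_right_le.
rewrite /= /GRing.scale/= ler_pdivlMl// [t *: v + _]addrC.
by apply: gs; rewrite t0.
Unshelve. all: end_near. Qed.

Lemma diff_le (R : realType) (W : normedModType R) (g : W -> R) (w0 v : W) (s : R) :
  differentiable g w0 ->
  (forall t, 0 < t <= 1 -> g (w0 + t *: v) - g w0 <= t * s) -> 'd g w0 v <= s.
Proof.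
move=> dg gs; rewrite -lerN2 -[leRHS]/((- ('d g w0 : W -> R)) v) -diffN//.
apply: diff_ge; first exact: differentiableN.
by move=> t t01; have := gs t t01; rewrite !fctE; lra.
Qed.

Lemma partial1E (R : realType) (P X Y : normedModType R) (f : P * X -> Y) w h :
  differentiable f w -> partial1 f w h = 'd f w (h, 0).
Proof.
case: w => p x df; rewrite /partial1/=.
have dpair : is_diff p (fun q : P => (q, x)) (fun q => (q, 0)).
  have := is_diff_pair (is_diff_id p) (is_diff_cst x p); exact.
have -> : (fun q => f (q, x)) = f \o (fun q => (q, x)) by [].
by rewrite diff_comp//= ?diff_val//; exact: ex_diff.
Qed.

Lemma partial2E (R : realType) (P X Y : normedModType R) (f : P * X -> Y) w h :
  differentiable f w -> partial2 f w h = 'd f w (0, h).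
Proof.
case: w => p x df; rewrite /partial2/=.
have dpair : is_diff x (fun z : X => (p, z)) (fun z => (0, z)).
  have := is_diff_pair (is_diff_cst p x) (is_diff_id x); exact.
have -> : (fun z => f (p, z)) = f \o (fun z => (p, z)) by [].
by rewrite diff_comp//= ?diff_val//; exact: ex_diff.
Qed.

(** * Normals to the constraint set and multipliers *)

Lemma contingent_normal (R : realType) (W : normedModType R) (w0 d : W)
    (A : set W) (n : {scalar W}) :
  continuous (n : W -> R) -> (forall w, A w -> n (w - w0) <= 0) ->
  contingent_cone w0 A d -> n d <= 0.
Proof.
move=> cn nA [tau [e [tau0 _ cvge Ae]]].
apply: (cvgr_to_le (continuous_cvg _ (cn d) cvge)).
apply: nearW => k; have := nA _ (Ae k).
by rewrite addrC addKr linearZ/= pmulr_rle0.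
Qed.

(** A normal is nonpositive on the contingent cone, hence under the constraint
    qualification on the polyhedral cone of the active gradients, where Farkas'
    lemma applies; inactive inequalities get the multiplier 0, which is
    complementary slackness. *)
Lemma acq_normal_multipliers (R : realType) (P X : normedModType R) (m r : nat)
    (g : 'I_(m + r) -> P * X -> R) (C : P -> set X) (w0 : P * X)
    (n : {scalar (P * X)%type}) :
  ACQ g C w0 -> continuous (n : P * X -> R) ->
  (forall w, gph C w -> n (w - w0) <= 0) ->
  exists lam : 'rV[R]_(m + r),
    (forall d, n d = \sum_i lam 0 i * 'd (g i) w0 d) /\
    (forall i : 'I_(m + r), (i < m)%N -> 0 <= lam 0 i /\ lam 0 i * g i w0 = 0).
Proof.
move=> acq cn nC.
have [d dineq deqn|lam [nE lam_ge0 lam0]] := @mixed_farkas R _ _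
  (fun i => (i < m)%N && (g i w0 == 0)) (fun i => (m <= i)%N)
  (fun i => 'd (g i) w0) n.
  apply: contingent_normal cn nC _; apply: acq; split => // i im gi0.
  by apply: dineq; rewrite im gi0 eqxx.
exists (\row_i lam i); split=> [d|i im].
  by rewrite nE; apply: eq_bigr => i _; rewrite mxE.
rewrite mxE lam_ge0 -?ltnNge//; split => //.
have [->|gi] := eqVneq (g i w0) 0; first by rewrite mulr0.
by rewrite lam0 ?mul0r -?ltnNge// negb_and gi orbT.
Qed.

(** For an inequality the gradient inequality of a convex function suffices. For
    an equality the multiplier has no sign, but the constraint vanishes on the
    whole segment from w0 to w, which lies in the convex graph, so its
    derivative in that direction is 0. *)
Lemma multipliers_normal (R : realType) (P X : normedModType R) (m r : nat)
    (g : 'I_(m + r) -> P * X -> R) (w0 w : P * X) (lam : 'rV[R]_(m + r)) :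
  (forall i, differentiable (g i) w0) ->
  (forall i, convex_function setT (g i)) ->
  convex_set (gph (constraint_map g)) ->
  gph (constraint_map g) w0 -> gph (constraint_map g) w ->
  (forall i : 'I_(m + r), (i < m)%N -> 0 <= lam 0 i /\ lam 0 i * g i w0 = 0) ->
  \sum_i lam 0 i * 'd (g i) w0 (w - w0) <= 0.
Proof.
case: w0 w => p0 x0 [p x] dg cg cC C0 Cw lamP; apply: sumr_le0 => i _.
case: (ltnP i m) => im.
  have [lam0 lamg] := lamP i im.
  have : 'd (g i) (p0, x0) ((p, x) - (p0, x0)) <= g i (p, x) - g i (p0, x0).
    apply: diff_le => // t /andP[t0 t1].
    by apply: convex_function_segment; rewrite // (ltW t0).
  move=> /(ler_wpM2l lam0)/le_trans; apply.
  rewrite mulrBr lamg subr0 mulr_ge0_le0//; exact: (Cw.1 i im).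
have on_segment t : 0 < t <= 1 ->
    g i ((p0, x0) + t *: ((p, x) - (p0, x0))) - g i (p0, x0) = 0.
  move=> /andP[t0 t1].
  have Ct : gph (constraint_map g) ((p0, x0) + t *: ((p, x) - (p0, x0))).
    by apply: convex_segment; rewrite // (ltW t0).
  by rewrite (Ct.2 i im) (C0.2 i im) subrr.
have -> : 'd (g i) (p0, x0) ((p, x) - (p0, x0)) = 0; last by rewrite mulr0.
apply/le_anti/andP; split; [apply: diff_le|apply: diff_ge] => // t /on_segment ->;
  by rewrite mulr0.
Qed.

(** * Frechet normals and the graph of the perturbation map *)

Lemma sum_norm_gt0 (R : realType) (U V : normedModType R) (w : U * V) :
  w != 0 -> 0 < sum_norm w.
Proof.
case: w => u v; rewrite xpair_eqE negb_and -!normr_gt0 /sum_norm/=.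
by case/orP => ?; [rewrite ltr_pwDl|rewrite ltr_wpDl].
Qed.

Lemma sum_normZ (R : realType) (U V : normedModType R) (a : R) (w : U * V) :
  sum_norm (a *: w) = `|a| * sum_norm w.
Proof. by rewrite /sum_norm !normrZ mulrDr. Qed.

(** If l were positive at w - w0 for some w in B, then along the segment from w0
    to w the difference quotient would keep its positive value at w, and points
    of this segment near w0 belong to A; so the upper limit would be positive. *)
Lemma frechet_normal_cone_locally_convex (R : realType) (U V : normedModType R)
    (w0 : U * V) (A B : set (U * V)) :
  convex_set B -> B w0 -> (\forall w \near w0, A w <-> B w) ->
  frechet_normal_cone w0 A = normal_cone w0 B.
Proof.
move=> cB Bw0 AB; apply/seteqP; split=> l [dl nl]; split => //; last first.
  apply: le_trans (ereal_inf_lbound _) _.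
    exists [set w | l (w - w0) <= 0] => //.
    by apply: filterS AB => w ABw _ /ABw; exact: nl.
  apply: ge_ereal_sup => _ [w lw <-].
  by rewrite lee_fin mulr_le0_ge0// invr_ge0 addr_ge0.
move=> w Bw; rewrite leNgt; apply/negP => lw.
have [L LE] := scalar_bundle dl.1.
have w_neq : w - w0 != 0.
  by apply: contraTneq lw => ->; rewrite LE linear0 ltxx.
have sw0 := sum_norm_gt0 w_neq.
suff : ((l (w - w0) / sum_norm (w - w0))%:E <= 0)%E.
  by rewrite lee_fin leNgt divr_gt0.
apply: le_trans nl; apply: le_ereal_inf_tmp => _ [S nS <-].
have cvg_w0 : (w0 + t *: (w - w0)) @[t --> 0^'+] --> w0.
  rewrite -[X in _ --> X]addr0 -(scale0r (w - w0)).
  apply: cvgD; first exact: cvg_cst.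
  apply: cvgZr_tmp; exact/cvg_at_right_filter/cvg_id.
have nS' : \forall u \near w0, u != w0 -> A u -> S u by exact: nS.
(* A point of the segment so close to w0 that it lies in A and in S. *)
near (0 : R)^'+ => t.
have t0 : 0 < t by near: t; exact: nbhs_right_gt.
have t1 : t <= 1 by near: t; exact: nbhs_right_le.
have [St ABt] : [set u | (u != w0 -> A u -> S u) /\ (A u <-> B u)] (w0 + t *: (w - w0)).
  by near: t; exact: (@cvg_w0 _ (filterI nS' AB)).
have Bt : B (w0 + t *: (w - w0)) by apply: convex_segment => //; rewrite (ltW t0).
apply: ereal_sup_ubound; exists (w0 + t *: (w - w0)); last first.
  rewrite addrC addKr LE linearZ/= sum_normZ gtr0_norm//.
  by rewrite -mulf_div divff ?mul1r ?gt_eqF.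
apply: St; last exact/ABt.
by rewrite -subr_eq0 addrC addKr scaler_eq0 negb_or w_neq gt_eqF.
Unshelve. all: end_near. Qed.

Lemma gph_objective_profileP (R : realType) (P X Y : normedModType R) (K : set Y)
    (f : P * X -> Y) (C : P -> set X) p y :
  gph (profile K (objective_map f C)) (p, y) <->
  exists2 x, C p x & epi K (sv_of_fun f) ((p, x), y).
Proof.
split=> [[z [x Cx ->] [k Kk /= <-]]|[x Cx [z -> [k Kk /= <-]]]].
  by exists x => //; exists (f (p, x)) => //; exists k.
by exists (f (p, x)); [exists x|exists k].
Qed.

Lemma convex_objective_profile (R : realType) (P X Y : normedModType R) (K : set Y)
    (f : P * X -> Y) (C : P -> set X) :
  convex_set (epi K (sv_of_fun f)) -> convex_set (gph C) ->
  convex_set (gph (profile K (objective_map f C))).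
Proof.
move=> /convex_setP cf /convex_setP cC; apply/convex_setP => -[p y] [p' y'] t t01.
move=> /gph_objective_profileP[x Cx fxy] /gph_objective_profileP[x' Cx' fxy'].
apply/gph_objective_profileP; exists (t *: x + (1 - t) *: x').
  exact: (cC (p, x) (p', x') _ t01 Cx Cx').
exact: (cf ((p, x), y) ((p', x'), y') _ t01 fxy fxy').
Qed.

Lemma dominated_profile (R : realType) (P X Y : normedModType R) (K : set Y)
    (f : P * X -> Y) (C : P -> set X)
    (F := objective_map f C) (M := perturbation_map K f C) (p0 : P) (y0 : Y) :
  convex_set K -> is_cone K -> dominated_near K F M p0 ->
  \forall w \near (p0, y0), gph (profile K M) w <-> gph (profile K F) w.
Proof.
move=> Kconvex Kcone dom.
have nFM : \forall w \near (p0, y0), F w.1 `<=` set_add (M w.1) K.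
  exact: (cvg_fst dom).
apply: filterS nFM => -[p y] /= FM; split=> -[z].
  by move=> [Fz _] [k Kk /= <-]; exists z => //; exists k.
move=> /FM[a Ma [k' Kk' <-]] [k Kk /= <-]; exists a => //.
by exists (k' + k); [exact: convex_cone_add|rewrite addrA].
Qed.

Lemma frechet_perturbationE (R : realType) (P X Y : normedModType R) (K : set Y)
    (f : P * X -> Y) (C : P -> set X)
    (F := objective_map f C) (M := perturbation_map K f C)
    (p0 : P) (x0 : X) (v : Y -> R) :
  convex_set K -> is_cone K ->
  convex_set (epi K (sv_of_fun f)) -> convex_set (gph C) ->
  C p0 x0 -> dominated_near K F M p0 ->
  frechet_coderivative (profile K M) (p0, f (p0, x0)) v =
  coderivative (profile K F) (p0, f (p0, x0)) v.
Proof.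
move=> Kconvex Kcone cf cC C0 dom; rewrite /frechet_coderivative /coderivative.
rewrite (@frechet_normal_cone_locally_convex _ _ _ _ _ (gph (profile K F)))//.
- exact: convex_objective_profile.
- apply/gph_objective_profileP; exists x0 => //.
  by exists (f (p0, x0)) => //; exists 0; rewrite ?addr0//; exact: Kcone.1.
- exact: dominated_profile.
Qed.

(** * The coderivative of a differentiable convex map *)

(** An element q of the coderivative is below the directional derivative of
    v o f in every direction, and two linear functionals that are comparable
    everywhere are equal. Conversely v o f is convex, since v is nonnegative
    on K, and lies above its linearization. *)
Lemma gradient_coderivativeP (R : realType) (W Y : normedModType R) (K : set Y)
    (f : W -> Y) (w0 : W) (v : Y -> R) (q : W -> R) :
  is_cone K -> convex_set (epi K (sv_of_fun f)) -> differentiable f w0 ->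
  dual_cone K v ->
  coderivative (profile K (sv_of_fun f)) (w0, f w0) v q <-> q = v \o 'd f w0.
Proof.
move=> Kcone cf df [dv vK].
have epif w : epi K (sv_of_fun f) (w, f w).
  by exists (f w) => //; exists 0; rewrite ?addr0//; exact: Kcone.1.
have [V VE] := scalar_bundle dv.1; subst v.
have cV : continuous (V : Y -> R) := dv.2.
have dV : differentiable (V : Y -> R) (f w0) by exact: linear_differentiable.
have dVf : differentiable (V \o f) w0 by exact: differentiable_comp.
have dVfE h : 'd (V \o f) w0 h = V ('d f w0 h).
  by rewrite diff_comp// diff_lin.
have ddf : dual (V \o 'd f w0).
  split; first by move=> a x y /=; rewrite !linearP.
  by move=> w; apply: continuous_comp; [exact: diff_continuous|exact: cV].
split=> [[dq qle]|->].
  have dq' : dual q by apply: dual_pairing_fst dq _; rewrite linear0 oppr0.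
  have [Q QE] := scalar_bundle dq'.1; subst q.
  have Qle h : Q h <= V ('d f w0 h).
    rewrite -dVfE; apply: diff_ge => // t _ /=.
    have := qle (w0 + t *: h, f (w0 + t *: h)) (epif _).
    by rewrite /pairing/= [w0 + _]addrC addrK linearZ/= linearB subr_le0.
  apply/funext => h; apply/le_anti; rewrite Qle/=.
  by have := Qle (- h); rewrite !linearN/= lerN2.
split; first by apply: dual_pairing => //; exact: dualN.
move=> [w _] [_ -> [k Kk /= <-]].
rewrite /pairing/= subr_le0 -dVfE; apply: diff_le => // t /andP[t0 t1] /=.
have t01 : 0 <= t <= 1 by rewrite ltW.
(* Convexity along K: the chord is above f up to an element of K. *)
have [_ -> [k' Kk' /= eqk]] := convex_segment cf (epif w0) (epif w) t01.
have := vK _ Kk; have := vK _ Kk' => k'0 k0.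
have : V (f (w0 + t *: (w - w0))) + V k' = V (f w0) + t * (V (f w) - V (f w0)).
  by rewrite -linearD eqk [in LHS]linearD linearZ/= linearB.
have := mulr_ge0 (ltW t0) k0; rewrite linearB linearD; lra.
Qed.

(** * The coderivative of the perturbation map *)

Theorem theorem5 (R : realType) (P X Y : completeNormedModType R) (K : set Y)
  (Kpointed : pointed K) (Kclosed : closed K) (Kconvex : convex_set K)
  (Kcone : is_cone K)
  (f : P * X -> Y)
  (fclosed : closed (epi K (sv_of_fun f)))
  (fconvex : convex_set (epi K (sv_of_fun f)))
  (m r : nat) (g : 'I_(m + r) -> P * X -> R)
  (gC1 : forall i w, continuously_differentiable_at (g i) w)
  (gconvex : forall i, convex_function setT (g i))
  (C : P -> set X) (CE : C = constraint_map g)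
  (Cclosed : closed (gph C)) (Cconvex : convex_set (gph C))
  (pbar : P) (xbar : X) (Sbar : gph (solution_map K f C) (pbar, xbar))
  (ybar : Y) (ybarE : ybar = f (pbar, xbar))
  (H : P -> set (P * X)) (HE : forall p, H p = [set p] `*` C p)
  (cond_i : closed_subspace
     (cone_hull (set_sub (rge H) (svdom (sv_of_fun f)))))
  (cond_ii : closed_subspace (cone_hull (set_sub setT (svdom C))))
  (acq : ACQ g C (pbar, xbar))
  (dom : dominated_near K (objective_map f C) (perturbation_map K f C) pbar) :
  (forall ystar, dual ystar ->
     frechet_coderivative (profile K (perturbation_map K f C)) (pbar, ybar)
       ystar =
     \bigcup_(d in [set d : (P -> R) * (X -> R) |
         coderivative (profile K (sv_of_fun f))
           ((pbar, xbar), f (pbar, xbar)) ystar (pairing d.1 d.2)])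
     \bigcup_(lam in multipliers g (pbar, xbar) d.2)
       [set (fun h => d.1 h +
          \sum_i lam 0 i * partial1 (g i) (pbar, xbar) h)]) /\
  (continuously_differentiable_at f (pbar, xbar) ->
   forall ystar, dual_cone K ystar ->
     frechet_coderivative (profile K (perturbation_map K f C)) (pbar, ybar)
       ystar =
     \bigcup_(lam in multipliers g (pbar, xbar)
                       (adjoint (partial2 f (pbar, xbar)) ystar))
       [set (fun h => adjoint (partial1 f (pbar, xbar)) ystar h +
          \sum_i lam 0 i * partial1 (g i) (pbar, xbar) h)]).
Proof.
have [Cx0 _] : C pbar xbar /\ _ := Sbar.
have C0 : gph C (pbar, xbar) := Cx0.
pose w0 : P * X := (pbar, xbar).
have dg i : differentiable (g i) w0 := nbhs_singleton (gC1 i w0).1.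
have f0 w : epi K (sv_of_fun f) (w, f w).
  by exists (f w) => //; exists 0; rewrite ?addr0//; exact: Kcone.1.
have dpartial i : dual (partial1 (g i) w0).
  have := dual_diff (dg i).
  have -> : 'd (g i) w0 = pairing (partial1 (g i) w0) (partial2 (g i) w0) :> (_ -> _).
    by apply/funext => -[p x]; rewrite /pairing/= partial1E// partial2E// -linearD -prod_split.
  by move=> /dual_pairing_fst; apply; rewrite partial2E// linear0.
have general ystar : dual ystar ->
     frechet_coderivative (profile K (perturbation_map K f C)) (pbar, ybar)
       ystar =
     \bigcup_(d in [set d : (P -> R) * (X -> R) |
         coderivative (profile K (sv_of_fun f))
           ((pbar, xbar), f (pbar, xbar)) ystar (pairing d.1 d.2)])
     \bigcup_(lam in multipliers g (pbar, xbar) d.2)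
       [set (fun h => d.1 h +
          \sum_i lam 0 i * partial1 (g i) (pbar, xbar) h)].
  move=> dy; rewrite ybarE frechet_perturbationE//.
  have dNy := dualN dy.
  have Ny0 : - ystar 0 = 0 by rewrite dual0// oppr0.
  apply/seteqP; split=> [u [duy uC]|u [[a b] [/= dab abf] [lam [lamb lamg] ->]]].
    have du : dual u := dual_pairing_fst duy Ny0.
    have [U UE] := scalar_bundle du.1; subst u.
    have [V VE] := scalar_bundle dy.1; subst ystar.
    have [n nE] : exists n : {scalar (P * X)%type}, U \o fst = n.
      by apply: scalar_bundle => c w z /=; rewrite !linearP.
    have cn : continuous (n : P * X -> R).
      rewrite -nE => w; apply: continuous_comp; [exact: cvg_fst|exact: du.2].
    have [|w y Cw fwy|q [cq qf qC]] := @convex_graph_sum_rule R _ _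
      (epi K (sv_of_fun f)) (gph C) w0 (f w0) n V fclosed fconvex
      _ Cconvex C0 (f0 w0) dy.2.
    - by move=> w; exists (f w).
    - have := uC (w.1, y); rewrite /pairing/= -nE/= subr_le0; apply.
      by apply/gph_objective_profileP; exists w.2; case: w Cw fwy.
    (* The part of u o fst that is normal to gph C. *)
    have [nq nqE] : exists l : {scalar (P * X)%type}, (fun w => n w - q w) = l.
      by apply: scalar_bundle => c w z /=; rewrite !linearP /GRing.scale/=; ring.
    have [||lam [lamE lamP]] := @acq_normal_multipliers R P X m r g C w0 nq acq.
    - by rewrite -nqE => w; apply: continuousB; [exact: cn|exact: cq].
    - by move=> w /qC; rewrite -nqE subr_le0.
    have splitE d : n d = q d + \sum_i lam 0 i * 'd (g i) w0 d.
      by rewrite -lamE -nqE addrC subrK.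
    (* The two components of q are the required pair. *)
    have qE : pairing (fun p => q (p, 0)) (fun x => q (0, x)) = q.
      by apply/funext => -[p x]; rewrite /pairing/= -linearD -prod_split.
    have dq : dual q by split => //; exact: linearP.
    exists (fun p => q (p, 0), fun x => q (0, x)) => /=.
      rewrite qE; split; first exact: dual_pairing.
      by move=> [w y] fwy; rewrite /pairing/= subr_le0; exact: qf.
    (* Restricting splitE to X and to P. *)
    exists lam; first split => //.
      move=> h; under eq_bigr do rewrite partial2E//.
      by have := splitE (0, h); rewrite -nE/= linear0 => ?; lra.
    apply/funext => h; under eq_bigr do rewrite partial1E//.
    by rewrite -splitE -nE.
  have dq : dual (pairing a b) := dual_pairing_fst dab Ny0.
  (* Only the pairing is known to be linear; the multiplier equation at 0 fixes
     the constant that could be moved between a and b. *)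
  have b0 : b 0 = 0.
    apply: oppr_inj; rewrite lamb oppr0 big1// => i _.
    by rewrite partial2E// linear0 mulr0.
  have a0 : a 0 = 0 by have := dual0 dq; rewrite /pairing/= b0 addr0.
  have da : dual a := dual_pairing_fst dq b0.
  have db : dual b := dual_pairing_snd dq a0.
  split.
    apply: dual_pairing => //; split.
      move=> c x y; rewrite da.1 mulrDr addrACA; congr (_ + _).
      exact: (dual_lin_comb _ dpartial).1.
    by move=> x; apply: continuousD; [exact: da.2|exact: (dual_lin_comb _ dpartial).2].
  move=> [p y] /gph_objective_profileP[x Cpx fxy].
  have := abf (p, x, y) fxy.
  have := multipliers_normal dg gconvex _ _ _ lamg.
  rewrite -CE => /(_ (p, x) Cconvex C0 Cpx).
  have := lamb (x - xbar).
  rewrite /pairing/=.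
  have -> : \sum_i lam 0 i * 'd (g i) w0 ((p, x) - w0) =
    \sum_i lam 0 i * partial1 (g i) w0 (p - pbar) +
    \sum_i lam 0 i * partial2 (g i) w0 (x - xbar).
    rewrite -big_split/=; apply: eq_bigr => i _.
    by rewrite partial1E// partial2E// -mulrDr -linearD -prod_split.
  rewrite -/w0; lra.
split=> [//|fC1 ystar dKy].
have df : differentiable f w0 := nbhs_singleton fC1.1.
rewrite general; last exact: dKy.1.
have gradE : pairing (adjoint (partial1 f w0) ystar) (adjoint (partial2 f w0) ystar) =
    ystar \o 'd f w0.
  apply/funext => -[p x].
  rewrite /pairing /adjoint/= partial1E// partial2E//.
  have [V ->] := scalar_bundle dKy.1.1.
  by rewrite -!linearD -prod_split.
apply/seteqP; split=> [u [[a b]/= abf [lam lamP ->]]|u [lam lamP ->]].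
  have abE : pairing a b = ystar \o 'd f w0.
    exact/(gradient_coderivativeP (w0 := w0) _ Kcone fconvex df dKy).
  have b0 : b 0 = 0.
    apply: oppr_inj; rewrite lamP.1 oppr0 big1// => i _.
    by rewrite partial2E// linear0 mulr0.
  have a0 : a 0 = 0.
    have := congr1 (@^~ 0) abE; rewrite /pairing/= b0 addr0 linear0 => ->.
    exact: dual0 dKy.1.
  have aE : a = adjoint (partial1 f w0) ystar.
    apply/funext => h; have := congr1 (@^~ (h, 0)) abE.
    by rewrite /pairing/= b0 addr0 /adjoint/= partial1E.
  have bE : b = adjoint (partial2 f w0) ystar.
    apply/funext => h; have := congr1 (@^~ (0, h)) abE.
    by rewrite /pairing/= a0 add0r /adjoint/= partial2E.
  by exists lam; rewrite -?bE -?aE.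
exists (adjoint (partial1 f w0) ystar, adjoint (partial2 f w0) ystar) => /=.
  by rewrite gradE; apply/gradient_coderivativeP.
by exists lam.
Qed.
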